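(* Let $X$ be an Archimedean vector lattice admitting a minimal topology $\tau$. Assume that the universal completion $X^u$ of $X$ has the countable sup property. Then a sequence $(x_n)$ in $X$ is $\tau$-convergent to zero in $X$ if and only if every subsequence of $(x_n)$ has a further subsequence that $uo$-converges to zero in $X$.
   Context: All vector lattices are assumed Archimedean. A linear topology on a vector lattice is locally solid if it has a base at zero consisting of solid sets. A minimal topology on $X$ is a Hausdorff locally solid topology on $X$ such that there is no strictly coarser Hausdorff locally solid topology on $X$. A net $(x_\alpha)$ converges in order to $x$, $x_\alpha\xrightarrow{o}x$, if there is a net $(y_\beta)$, possibly over a different index set, with $y_\beta\downarrow 0$ and such that for every $\beta$ there is $\alpha_0$ with $|x_\alpha-x|\le y_\beta$ for all $\alpha\ge\alpha_0$. The net $uo$-converges to $x$ if $|x_\alpha-x|\wedge u\xrightarrow{o}0$ for every $u\in X_+$. $X^u$ denotes the universal completion of $X$: the (unique up to lattice isomorphism) universally complete (i.e. order complete and laterally complete, meaning every set of pairwise disjoint positive vectors has a supremum) vector lattice containing $X$ as an order dense sublattice. A vector lattice has the countable sup property if every non-empty subset possessing a supremum contains an at most countable subset with the same supremum. *)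

(* Defs.v *)
From HB Require Import structures.
From mathcomp Require Import all_boot all_order all_algebra.
From mathcomp Require Import all_classical all_reals all_analysis.

Set Implicit Arguments.
Unset Strict Implicit.
Unset Printing Implicit Defensive.

Import Order.TTheory GRing.Theory Num.Theory.
Import numFieldNormedType.Exports.

Local Open Scope classical_set_scope.
Local Open Scope ring_scope.

(* Ordered vector spaces in which any two elements have a least upper bound and
   a greatest lower bound. The operations are fields of the mixin because
   Hierarchy Builder rejects a structure inheriting from both GRing.Lmodule and
   Order.Lattice: realDomainType already inherits from Order.Lattice and
   GRing.Zmodule without a declared join of the two. *)
HB.mixin Record POrderedZmodule_isVectorLattice (R : numDomainType) V
    & Num.POrderedZmodule V & GRing.Lmodule R V := {
  vjoin : V -> V -> V ;
  vmeet : V -> V -> V ;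
  vlat_leD2r : forall x y z : V, x <= y -> x + z <= y + z ;
  vlat_leZ : forall (a : R) (x y : V), 0 <= a -> x <= y -> a *: x <= a *: y ;
  vleUx : forall x y z : V, (vjoin x y <= z) = (x <= z) && (y <= z) ;
  vlexI : forall x y z : V, (z <= vmeet x y) = (z <= x) && (z <= y)
}.

#[short(type="vectorLatticeType")]
HB.structure Definition VectorLattice (R : numDomainType) :=
  {V of Num.POrderedZmodule V & GRing.Lmodule R V
      & POrderedZmodule_isVectorLattice R V}.

Section VectorLatticeDefs.
Context {R : realType}.
Implicit Type X : vectorLatticeType R.

Definition vabs X (x : X) : X := vjoin x (- x).

Definition archimedean X :=
  forall x y : X, 0 <= x -> (forall n : nat, x *+ n <= y) -> x = 0.

(* [has_sup A] only says that A is nonempty and bounded above. *)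
Definition order_complete X :=
  forall A : set X, has_sup A -> supremums A !=set0.

(* The empty family is excluded: its supremum would be a least element of X,
   which only the zero vector lattice has. *)
Definition laterally_complete X :=
  forall A : set X, A !=set0 -> (forall a, A a -> 0 <= a) ->
    (forall a b, A a -> A b -> a != b -> vmeet a b = 0) ->
    supremums A !=set0.

Definition universally_complete X :=
  order_complete X /\ laterally_complete X.

Definition countable_sup_property X :=
  forall (A : set X) (s : X), A !=set0 -> supremums A s ->
    exists B : set X, [/\ B `<=` A, countable B & supremums B s].

(* The universal completion of X is unique up to lattice isomorphism, so it is
   given by its defining property, through the embedding i of X. *)
Record is_universal_completion X (Xu : vectorLatticeType R)
    (i : {linear X -> Xu}) : Prop := {
  ucompl_inj : injective i ;
  ucompl_join : {morph i : x y / vjoin x y} ;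
  ucompl_meet : {morph i : x y / vmeet x y} ;
  ucompl_order_dense : forall u : Xu, 0 < u -> exists x : X, 0 < i x <= u ;
  ucompl_complete : universally_complete Xu
}.

Record directed (I : Type) (leI : I -> I -> Prop) : Prop := {
  directed_inhabited : inhabited I ;
  directed_refl : forall i, leI i i ;
  directed_trans : forall i j k, leI i j -> leI j k -> leI i k ;
  directed_ub : forall i j, exists2 k, leI i k & leI j k
}.

Definition decreases_to0 X (J : Type) (leJ : J -> J -> Prop) (y : J -> X) :=
  (forall j k, leJ j k -> y k <= y j) /\ infimums (range y) 0.

Definition order_cvg X (I : Type) (leI : I -> I -> Prop) (x : I -> X) (l : X) :=
  exists (J : Type) (leJ : J -> J -> Prop) (y : J -> X),
    [/\ directed leJ, decreases_to0 leJ y &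
        forall j, exists i0, forall i, leI i0 i -> vabs (x i - l) <= y j].

Definition uo_cvg X (I : Type) (leI : I -> I -> Prop) (x : I -> X) (l : X) :=
  forall u : X, 0 <= u ->
    order_cvg leI (fun i => vmeet (vabs (x i - l)) u) 0.

Definition seq_uo_cvg X (x : nat -> X) (l : X) :=
  uo_cvg (fun m n : nat => (m <= n)%N) x l.

Definition solid X (A : set X) :=
  forall x y : X, A x -> vabs y <= vabs x -> A y.

End VectorLatticeDefs.

Record topology (T : Type) := Topology {
  topo_open : set_system T ;
  topo_openT : topo_open setT ;
  topo_openI : setI_closed topo_open ;
  topo_open_bigU : forall (I : Type) (f : I -> set T),
    (forall i, topo_open (f i)) -> topo_open (\bigcup_i f i)
}.

(* Copy of T carrying the topology tau: several topologies on one vector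
   lattice have to be compared, so none can be canonical on T itself. *)
Definition topologized (T : Type) (tau : topology T) : Type := T.

Section Topologized.
Context {R : numDomainType} {X : vectorLatticeType R} (tau : topology X).

HB.instance Definition _ := VectorLattice.on (topologized tau).
HB.instance Definition _ := isOpenTopological.Build (topologized tau)
  (topo_openT tau) (@topo_openI _ tau) (@topo_open_bigU _ tau).

End Topologized.

Section LocallySolid.
Context {R : realType} {X : vectorLatticeType R}.
Implicit Type tau : topology X.

Definition linear_topology tau :=
  let T := topologized tau in
  continuous (fun z : T * T => z.1 + z.2) /\
  continuous (fun z : R^o * T => z.1 *: z.2).

Definition locally_solid tau :=
  linear_topology tau /\
  forall V : set (topologized tau), nbhs 0 V ->
    exists A : set (topologized tau), [/\ nbhs 0 A, solid A & A `<=` V].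

Definition hausdorff_locally_solid tau :=
  hausdorff_space (topologized tau) /\ locally_solid tau.

Definition minimal_topology tau :=
  hausdorff_locally_solid tau /\
  ~ exists2 sigma : topology X,
      hausdorff_locally_solid sigma & topo_open sigma `<` topo_open tau.

Definition topo_cvg tau (x : nat -> X) (l : X) :=
  (x : nat -> topologized tau) @ \oo --> (l : topologized tau).

End LocallySolid.

Definition strictly_increasing (phi : nat -> nat) :=
  {homo phi : m n / (m < n)%N}.

(* Main.v *)
Require Import Defs.
From HB Require Import structures.
From mathcomp Require Import all_boot all_order all_algebra.
From mathcomp Require Import all_classical all_reals all_analysis.

(** Two facts about a minimal topology tau on X carry the proof. If A is a set
    of positive vectors, closed under addition, and no nonzero vector is disjoint
    from all of A, then the sets {x | |x| /\ a in W}, for a in A and W a solid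
    neighbourhood of zero, are a base at zero of a Hausdorff locally solid
    topology coarser than tau, so by minimality every neighbourhood of zero
    contains one of them ([minimal_unbounded]). With all positive vectors for A,
    this says that tau is unbounded. With A the positive vectors disjoint from
    some (d - v)^+, where d runs over a set directed downwards to zero and v is a
    small multiple of one of its elements, it gives that d is eventually small:
    tau is a Lebesgue topology ([minimal_lebesgue]). Both together make every
    uo-null sequence tau-null ([uo_cvg0_topo_cvg0]), and a sequence all of whose
    subsequences have tau-null subsequences is tau-null.

    For the converse, every disjoint set of positive vectors of X is countable:
    its image in the laterally complete X^u has a supremum, and a vector left out
    of a countable subset with the same supremum would be disjoint from that
    supremum ([countable_disjoint]). By the Lebesgue property the intersection of
    a sequence of solid neighbourhoods W k with W (k+1) + W (k+1) inside W k is a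
    band, and below each u > 0 there is a d > 0 disjoint from such a band
    ([carried_ex]). A maximal disjoint set of vectors d of this kind is countable,
    so a diagonal intersection produces one sequence W whose intersection is
    {0} ([normal_sequence_separating]).

    Given a tau-null sequence, a subsequence z with z k in W (k+1) has all its
    finite joins z k \/ ... \/ z (k+m) in W k. In an Archimedean X the gap
    between the upper bounds of a set and the set itself has infimum zero, so,
    once truncated by u, the tail from k on has an upper bound lying in W (k-1),
    again by the Lebesgue property. Hence a lower bound of all upper bounds of
    tails lies in every W k and is at most zero, that is, z is uo-null
    ([normal_sequence_uo_cvg0]). Upper bounds of tails replace the suprema that
    X need not have. *)

Set Implicit Arguments.
Unset Strict Implicit.
Unset Printing Implicit Defensive.

Import Order.TTheory GRing.Theory Num.Theory.
Import numFieldNormedType.Exports.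

Local Open Scope classical_set_scope.
Local Open Scope ring_scope.

(** * Arithmetic of vector lattices *)

Section VectorLatticeTheory.
Context {R : realType} {X : vectorLatticeType R}.
Implicit Types a b c x y z : X.

Lemma vleD2r x y z : (x + z <= y + z) = (x <= y).
Proof.
apply/idP/idP => [h|]; last exact: vlat_leD2r.
by rewrite -[x](addrK z) -[y](addrK z); exact: vlat_leD2r.
Qed.

Lemma vleD2l x y z : (z + x <= z + y) = (x <= y).
Proof. by rewrite ![z + _]addrC vleD2r. Qed.

Lemma vleD x y z t : x <= y -> z <= t -> x + z <= y + t.
Proof. by move=> xy zt; apply: (@le_trans _ _ (y + z)); rewrite ?vleD2r ?vleD2l. Qed.

Lemma vsub_ge0 x y : (0 <= y - x) = (x <= y).
Proof. by rewrite -(vleD2r 0 _ x) add0r subrK. Qed.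

Lemma vleBlDr x y z : (x - y <= z) = (x <= z + y).
Proof. by rewrite -(vleD2r (x - y) z y) subrK. Qed.

Lemma vleBrDr x y z : (x <= y - z) = (x + z <= y).
Proof. by rewrite -(vleD2r x (y - z) z) subrK. Qed.

Lemma vleN2 x y : (- x <= - y) = (y <= x).
Proof. by rewrite -(vsub_ge0 (- x)) opprK addrC vsub_ge0. Qed.

Lemma vleB x y z t : x <= y -> t <= z -> x - z <= y - t.
Proof. by move=> xy zt; apply: vleD; rewrite ?vleN2. Qed.

Lemma vaddr_ge0 x y : 0 <= x -> 0 <= y -> 0 <= x + y.
Proof. by move=> x0 y0; rewrite -[0]addr0; exact: vleD. Qed.

Lemma vmulrn_ge0 x n : 0 <= x -> 0 <= x *+ n.
Proof.
move=> x0; elim: n => [|n IH]; first by rewrite mulr0n.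
by rewrite mulrS; exact: vaddr_ge0.
Qed.

Lemma vleMn2 x y n : x <= y -> x *+ n <= y *+ n.
Proof.
move=> xy; rewrite -(vsub_ge0 (x *+ n)) -mulrnBl.
by apply: vmulrn_ge0; rewrite vsub_ge0.
Qed.

Lemma vle_joinl x y : x <= vjoin x y.
Proof. by have := lexx (vjoin x y); rewrite vleUx => /andP[]. Qed.

Lemma vle_joinr x y : y <= vjoin x y.
Proof. by have := lexx (vjoin x y); rewrite vleUx => /andP[]. Qed.

Lemma vge_meetl x y : vmeet x y <= x.
Proof. by have := lexx (vmeet x y); rewrite vlexI => /andP[]. Qed.

Lemma vge_meetr x y : vmeet x y <= y.
Proof. by have := lexx (vmeet x y); rewrite vlexI => /andP[]. Qed.

Lemma vle_meet2 x y z t : x <= y -> z <= t -> vmeet x z <= vmeet y t.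
Proof.
move=> xy zt; rewrite vlexI (le_trans _ xy) ?vge_meetl //.
by rewrite (le_trans _ zt) ?vge_meetr.
Qed.

Lemma vle_join2 x y z t : x <= y -> z <= t -> vjoin x z <= vjoin y t.
Proof.
move=> xy zt; rewrite vleUx (le_trans xy) ?vle_joinl //.
by rewrite (le_trans zt) ?vle_joinr.
Qed.

Lemma vmeet_ge0 x y : 0 <= x -> 0 <= y -> 0 <= vmeet x y.
Proof. by move=> x0 y0; rewrite vlexI x0. Qed.

Lemma vmeetC x y : vmeet x y = vmeet y x.
Proof. by apply: le_anti; rewrite !vlexI !vge_meetl !vge_meetr. Qed.

Lemma vmeet_l x y : x <= y -> vmeet x y = x.
Proof. by move=> xy; apply: le_anti; rewrite vge_meetl vlexI lexx. Qed.

Lemma vmeetDr x y z : vmeet x y + z = vmeet (x + z) (y + z).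
Proof.
apply: le_anti; rewrite vlexI !vleD2r vge_meetl vge_meetr /=.
by rewrite -vleBlDr vlexI !vleBlDr vge_meetl vge_meetr.
Qed.

(** Truncation by c is subadditive on the positive cone; this is what lets
    truncated neighbourhoods inherit the halving property, and what makes sums
    of vectors disjoint from c disjoint from c. *)
Lemma vmeet_subadd a b c : 0 <= a -> 0 <= b -> 0 <= c ->
  vmeet (a + b) c <= vmeet a c + vmeet b c.
Proof.
move=> a0 b0 c0; have bc0 := vmeet_ge0 b0 c0.
rewrite vmeetDr vlexI; apply/andP; split; last first.
  apply: (le_trans (vge_meetr _ _)).
  by rewrite -[leLHS]addr0 vleD2l.
rewrite addrC [a + _]addrC vmeetDr; apply: vle_meet2 => //.
by rewrite -[leLHS]addr0 vleD2l.
Qed.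

Lemma vmeet_mulrn a c n : 0 <= a -> 0 <= c ->
  vmeet (a *+ n) c <= vmeet a c *+ n.
Proof.
move=> a0 c0; elim: n => [|n IH].
  by rewrite !mulr0n; exact: vge_meetl.
rewrite !mulrS; apply: (le_trans (vmeet_subadd _ _ _)) => //.
  exact: vmulrn_ge0.
by rewrite vleD2l.
Qed.

(** For disjoint x and y the meet vanishes, and an upper bound of both is an
    upper bound of their sum. *)
Lemma vadd_le_join_meet x y : x + y <= vjoin x y + vmeet x y.
Proof.
rewrite [leRHS]addrC -vleBlDr vlexI !vleBlDr vleD2l vle_joinr.
by rewrite addrC vleD2l vle_joinl.
Qed.

Lemma vmulrn_ge0_inv x n : 0 <= x *+ n.+1 -> 0 <= x.
Proof.
move=> nx0; have n0 : (0 : R) <= n.+1%:R^-1 by rewrite invr_ge0.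
have := vlat_leZ _ _ _ n0 nx0; rewrite scaler0 -(scaler_nat n.+1 x) scalerA.
by rewrite mulVf ?scale1r ?pnatr_eq0.
Qed.

Lemma vle_abs x : x <= vabs x. Proof. exact: vle_joinl. Qed.
Lemma vleN_abs x : - x <= vabs x. Proof. exact: vle_joinr. Qed.

Lemma vabs_le x y : x <= y -> - x <= y -> vabs x <= y.
Proof. by move=> h1 h2; rewrite /vabs vleUx h1. Qed.

Lemma vabs_ge0 x : 0 <= vabs x.
Proof.
apply: (@vmulrn_ge0_inv _ 1); rewrite mulr2n -{1}(subrr x).
exact: vleD (vle_abs _) (vleN_abs _).
Qed.

Lemma vabs_id x : 0 <= x -> vabs x = x.
Proof.
move=> x0; apply: le_anti; rewrite vle_abs andbT; apply: vabs_le => //.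
by apply: (@le_trans _ _ 0) => //; rewrite -oppr0 vleN2.
Qed.

Lemma vabs0 : vabs (0 : X) = 0. Proof. exact: vabs_id. Qed.

Lemma vabs_eq0 x : vabs x = 0 -> x = 0.
Proof.
move=> x0; apply: le_anti.
by rewrite -{1}x0 vle_abs /= -vleN2 oppr0 -x0 vleN_abs.
Qed.

Lemma vabsN x : vabs (- x) = vabs x.
Proof.
by apply: le_anti; apply/andP; split; apply: vabs_le;
  rewrite ?opprK ?vle_abs ?vleN_abs// -{1}[x]opprK ?vleN_abs ?vle_abs.
Qed.

Lemma vabsB x y : vabs (x - y) = vabs (y - x).
Proof. by rewrite -vabsN opprB. Qed.

Lemma vabsD_le x y : vabs (x + y) <= vabs x + vabs y.
Proof. by apply: vabs_le; rewrite ?opprD; apply: vleD; rewrite ?vle_abs ?vleN_abs. Qed.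

Lemma vabsMn_le x n : vabs (x *+ n) <= vabs x *+ n.
Proof.
by apply: vabs_le; rewrite -?mulNrn; apply: vleMn2; rewrite ?vle_abs ?vleN_abs.
Qed.

Lemma vabsZ_le (r s : R) x : `|r| <= s -> vabs (r *: x) <= s *: vabs x.
Proof.
have pos (t : R) z : 0 <= t -> vabs (t *: z) <= t *: vabs z.
  by move=> t0; apply: vabs_le; rewrite -?scalerN; apply: vlat_leZ => //;
    rewrite ?vle_abs ?vleN_abs.
move=> rs; apply: (@le_trans _ _ (`|r| *: vabs x)); last first.
  rewrite -vsub_ge0 -scalerBl -[leLHS](scaler0 _ (s - `|r|)).
  by apply: vlat_leZ; rewrite ?subr_ge0 ?vabs_ge0.
have [r0|r0] := leP 0 r; first by rewrite ger0_norm //; exact: pos.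
by rewrite ltr0_norm // -vabsN -scaleNr; apply: pos; rewrite oppr_ge0 ltW.
Qed.

Definition vpos x : X := vjoin x 0.

Lemma vpos_ge0 x : 0 <= vpos x. Proof. exact: vle_joinr. Qed.
Lemma vle_pos x : x <= vpos x. Proof. exact: vle_joinl. Qed.

Lemma vpos_le2 x y : x <= y -> vpos x <= vpos y.
Proof. by move=> xy; exact: vle_join2. Qed.

(** From x^+ <= x + x^-, the meet is at most (x /\ 0) + x^-, which is zero. *)
Lemma vpos_disjoint x : vmeet (vpos x) (vpos (- x)) = 0.
Proof.
apply: le_anti; rewrite vmeet_ge0 ?vpos_ge0// andbT.
have h : vpos x <= x + vpos (- x).
  rewrite /vpos vleUx -{1}[x]addr0 vleD2l vle_joinr /=.
  by rewrite -(subrr x) vleD2l vle_joinl.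
apply: (le_trans (vle_meet2 h (lexx _))).
rewrite -[X in vmeet _ X]add0r -vmeetDr -[leRHS](subrr (vmeet x 0)) vleD2l.
by rewrite /vpos vleUx -[0]oppr0 !vleN2 oppr0 vge_meetl vge_meetr.
Qed.

End VectorLatticeTheory.

(** * Locally solid topologies from bases of solid sets *)

Lemma open_topologized (T : realType) (X : vectorLatticeType T)
    (tau : topology X) : (open : set_system (topologized tau)) = topo_open tau.
Proof. by []. Qed.

Section SolidBase.
Context {R : realType} {X : vectorLatticeType R}.
Implicit Types (x y : X) (B : set (set X)) (O V W : set X).

(** Neighbourhood bases at zero of Hausdorff locally solid topologies, described
    by set operations only. Absorption is by integers because solidity extends
    it to all small real factors. *)
Record solid_base B : Prop := {
  sbase_inhabited : B !=set0 ;
  sbase_solid : forall V, B V -> solid V ;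
  sbase_meet : forall V W, B V -> B W -> exists2 U, B U & U `<=` V `&` W ;
  sbase_half : forall V, B V ->
    exists2 W, B W & forall x y, W x -> W y -> V (x + y) ;
  sbase_absorbing : forall V x, B V -> exists n v, V v /\ x = v *+ n.+1 ;
  sbase_separated : forall x, (forall V, B V -> V x) -> x = 0
}.

Definition base_nbhs B x O := exists2 V, B V & forall y, V (y - x) -> O y.

Definition base_open B O := forall x, O x -> base_nbhs B x O.

Section Topology.
Variables (B : set (set X)) (hB : solid_base B).

Lemma sbase0 V : B V -> V 0.
Proof.
move=> BV; have [_ [v [Vv _]]] := sbase_absorbing hB 0 BV.
by apply: (sbase_solid hB BV Vv); rewrite vabs0 vabs_ge0.
Qed.

Lemma sbase_le V x y : B V -> V y -> 0 <= x -> x <= y -> V x.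
Proof.
move=> BV Vy x0 xy; apply: (sbase_solid hB BV Vy).
by rewrite !vabs_id //; exact: le_trans xy.
Qed.

Lemma sbase_abs V x : B V -> V x <-> V (vabs x).
Proof.
move=> BV; split => Vx; apply: (sbase_solid hB BV Vx);
by rewrite (vabs_id (vabs_ge0 x)).
Qed.

Lemma sbase_muln V n : B V ->
  exists2 W, B W & forall x, W x -> V (x *+ n).
Proof.
elim: n V => [|n IH] V BV.
  by exists V => // x _; rewrite mulr0n; exact: sbase0.
have [V' BV' hV'] := sbase_half hB BV.
have [W BW hW] := IH _ BV'; have [U BU UVW] := sbase_meet hB BV' BW.
by exists U => // x /UVW[V'x Wx]; rewrite mulrS; apply: hV' => //; exact: hW.
Qed.

Lemma base_nbhsI x O P : base_nbhs B x O -> base_nbhs B x P ->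
  base_nbhs B x (O `&` P).
Proof.
move=> [V BV VO] [W BW WP]; have [U BU UVW] := sbase_meet hB BV BW.
by exists U => // y /UVW[/VO Oy /WP Py].
Qed.

Lemma base_openT : base_open B setT.
Proof. by move=> x _; have [V BV] := sbase_inhabited hB; exists V. Qed.

Lemma base_openI : setI_closed (base_open B).
Proof. by move=> O P hO hP x [/hO Ox /hP Px]; exact: base_nbhsI. Qed.

Lemma base_open_bigU (I : Type) (f : I -> set X) :
  (forall i, base_open B (f i)) -> base_open B (\bigcup_i f i).
Proof.
by move=> hf x [i _ /hf[V BV Vf]]; exists V => // y /Vf fy; exists i.
Qed.

Definition base_topology : topology X :=
  Topology base_openT base_openI base_open_bigU.

(** The interior of O in the candidate topology is the set of points of which O
    is a basic neighbourhood; halving shows that this set is open. *)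
Lemma base_topologyE x O :
  nbhs (x : topologized base_topology) O <-> base_nbhs B x O.
Proof.
rewrite nbhsE; split => [[P [oP Px] PO]|xO].
  by have [V BV VP] := oP _ Px; exists V => // y /VP /PO.
exists [set y | base_nbhs B y O].
  split => //; rewrite open_topologized => y [V BV VO].
  have [W BW hW] := sbase_half hB BV.
  exists W => // z Wz; exists W => // t Wt; apply: VO.
  by rewrite -(subrK z t) -addrA; exact: hW.
by move=> y [V BV]; apply; rewrite subrr; exact: sbase0.
Qed.

Lemma base_hausdorff_locally_solid : hausdorff_locally_solid base_topology.
Proof.
split; [|split; [split|]].
- move=> x y xy; apply/eqP; rewrite -subr_eq0; apply/eqP.
  apply: (sbase_separated hB) => V BV; have [W BW hW] := sbase_half hB BV.
  have Nn z : nbhs (z : topologized base_topology) [set t | W (t - z)].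
    by apply/base_topologyE; exists W.
  have [z [/= /(sbase_abs _ BW) Wx Wy]] := xy _ _ (Nn x) (Nn y).
  rewrite -(subrK z x) -addrA; apply: hW => //.
  by apply/(sbase_abs _ BW); rewrite vabsB.
- move=> [x y] O /base_topologyE[V BV VO]; have [W BW hW] := sbase_half hB BV.
  exists ([set t | W (t - x)], [set t | W (t - y)]).
    by split; apply/base_topologyE; exists W.
  move=> [a b] [/= Wa Wb]; apply: VO.
  by rewrite opprD addrACA; exact: hW.
(* s y - r x = s (y - x) + (s - r) x: solidity absorbs the bounded factor s of
   the first summand, and x = (m + 1) v with v small handles the second. *)
- move=> [r x] O /base_topologyE[V BV VO]; have [W BW hW] := sbase_half hB BV.
  have [m [v [Wv xv]]] := sbase_absorbing hB x BW.
  pose n := Num.bound (`|r| + 1); have [U BU hU] := sbase_muln n BW.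
  exists ([set s | `|s - r| <= m.+1%:R^-1], [set y | U (y - x)]).
    split; last by apply/base_topologyE; exists U.
    have m0 : (0 : R) < m.+1%:R^-1 by rewrite invr_gt0.
    exact: (@cvgr_distC_le _ R^o _ _ _ idfun r cvg_id _ m0).
  move=> [s y] [/= sr /(sbase_abs _ BU) Uyx]; apply: VO.
  have sn : `|s| <= n%:R.
    apply: (@le_trans _ _ (`|r| + 1)); last exact/ltW/archi_boundP.
    rewrite -(subrK r s) addrC (le_trans (ler_normD _ _))// lerD2l.
    by rewrite (le_trans sr)// invf_le1 ?ltr0n// ler1n.
  have -> : s *: y - r *: x = s *: (y - x) + (s - r) *: x.
    by rewrite scalerBr scalerBl addrA subrK.
  apply: hW.
    apply/(sbase_abs _ BW); apply: (sbase_le BW (hU _ Uyx) (vabs_ge0 _)).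
    by rewrite -scaler_nat; exact: vabsZ_le.
  apply/(sbase_abs _ BW); have /(sbase_abs _ BW) Wv' := Wv.
  apply: (sbase_le BW Wv' (vabs_ge0 _)); apply: (le_trans (vabsZ_le _ sr)).
  have m0 : (0 : R) <= m.+1%:R^-1 by rewrite invr_ge0.
  rewrite xv; apply: (le_trans (vlat_leZ _ _ _ m0 (vabsMn_le v m.+1))).
  by rewrite -(scaler_nat m.+1 (vabs v)) scalerA mulVf ?scale1r ?pnatr_eq0.
- move=> V /base_topologyE[W BW WV]; exists W; split.
  + by apply/base_topologyE; exists W => // y; rewrite subr0.
  + exact: sbase_solid hB _ BW.
  + by move=> y Wy; apply: WV; rewrite subr0.
Qed.

End Topology.
End SolidBase.

(** * Minimality as a statement about bases *)

Section SolidNbhs.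
Context {R : realType} {X : vectorLatticeType R} (tau : topology X).
Implicit Types (x y : X) (B : set (set X)) (O V W : set X).

Definition solid_nbhs V := solid V /\ nbhs (0 : topologized tau) V.

Hypothesis hls : hausdorff_locally_solid tau.

Lemma solid_nbhs_sub V : nbhs (0 : topologized tau) V ->
  exists2 W, solid_nbhs W & W `<=` V.
Proof. by move=> /(hls.2.2 V)[W [W0 sW WV]]; exists W. Qed.

Lemma nbhs_shift x O : nbhs (x : topologized tau) O ->
  nbhs (0 : topologized tau) [set y : X | O (y + x)].
Proof.
move=> xO; have [/(_ (0, x))/= addc _] := hls.2.1.
have /addc[[P Q] [/= P0 Qx] PQ] :
    nbhs ((0 : topologized tau) + (x : topologized tau)) O by rewrite add0r.
apply: filterS P0 => y Py.
by apply: (PQ (y, x)); split => //=; exact: (nbhs_singleton Qx).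
Qed.

Lemma nbhs_unshift x O : nbhs (0 : topologized tau) [set y : X | O (y + x)] ->
  nbhs (x : topologized tau) O.
Proof.
move=> O0; have [/(_ (x, - x))/= addc _] := hls.2.1.
have /addc[[P Q] [/= Px Qx] PQ] :
    nbhs ((x : topologized tau) + (- x : topologized tau)) [set y : X | O (y + x)].
  by rewrite subrr.
apply: filterS Px => y Py.
have /= := PQ (y, - x); rewrite subrK; apply; split => //=.
exact: (nbhs_singleton Qx).
Qed.

Lemma nbhs_solidE x O :
  nbhs (x : topologized tau) O <-> base_nbhs solid_nbhs x O.
Proof.
split => [/nbhs_shift/solid_nbhs_sub[V hV VO]|[V [_ V0] VO]].
  by exists V => // y /VO /=; rewrite subrK.
by apply: nbhs_unshift; apply: filterS V0 => y Vy; apply: VO; rewrite addrK.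
Qed.

Lemma solid_nbhs_base : solid_base solid_nbhs.
Proof.
split.
- by exists setT; split => //; exact: filterT.
- by move=> V [].
- move=> V W [sV V0] [sW W0]; exists (V `&` W) => //; split.
    by move=> x y [/sV Vx /sW Wx] yx; split; [exact: Vx|exact: Wx].
  exact: filterI.
- move=> V [_ V0]; have [/(_ (0, 0))/= addc _] := hls.2.1.
  have /addc[[P Q] [/= P0 Q0] PQ] :
    nbhs ((0 : topologized tau) + (0 : topologized tau)) V by rewrite addr0.
  have [W hW WPQ] := solid_nbhs_sub (filterI P0 Q0).
  by exists W => // x y /WPQ[Px _] /WPQ[_ Qy]; exact: (PQ (x, y)).
- move=> V x [_ V0]; have [_ /(_ (0, x))/= sc] := hls.2.1.
  have /sc[[P Q] [/= P0 Qx] PQ] :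
    nbhs ((0 : R) *: (x : topologized tau)) V by rewrite scale0r.
  have [e /= e0 eP] : nbhs_ball (0 : R^o) P by apply/nbhs_ballP.
  have [n en] : exists n, n.+1%:R^-1 < e.
    by have [n _ hn] := near_infty_natSinv_lt (PosNum e0); exists n; exact: hn (leqnn n).
  exists n, (n.+1%:R^-1 *: x); split.
    apply: (PQ (_, x)); split => /=; last exact: (nbhs_singleton Qx).
    by apply: eP; rewrite /ball/= sub0r normrN gtr0_norm ?invr_gt0.
  by rewrite -scaler_nat scalerA mulfV ?scale1r ?pnatr_eq0.
- move=> x hx; apply: esym; apply: hls.1 => P Q /nbhs_solidE[V hV VP] xQ.
  exists x; split; last exact: (nbhs_singleton xQ).
  by apply: VP; rewrite subr0; exact: hx.
Qed.

Hypothesis mt : minimal_topology tau.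

(** A base of solid neighbourhoods with trivial intersection generates a
    Hausdorff locally solid topology coarser than tau, hence tau itself. *)
Lemma minimal_base B V : solid_base B -> (forall W, B W -> solid_nbhs W) ->
  solid_nbhs V -> exists2 W, B W & W `<=` V.
Proof.
move=> hB Btau [_]; rewrite nbhsE => -[Q [oQ Q0] QV].
have sub : topo_open (base_topology hB) `<=` topo_open tau.
  move=> P hP; rewrite -open_topologized openE => x /hP[W /Btau hW WP].
  by apply/nbhs_solidE; exists W.
have [W BW WQ] : base_nbhs B 0 Q.
  have : topo_open tau `<=` topo_open (base_topology hB).
    apply: contrapT => nsub; apply: mt.2; exists (base_topology hB).
      exact: base_hausdorff_locally_solid.
    by split.
  by apply.
by exists W => // x Wx; apply/QV/WQ; rewrite subr0.
Qed.

End SolidNbhs.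

(** * Minimal topologies are unbounded and Lebesgue *)

Section MinimalTopology.
Context {R : realType} {X : vectorLatticeType R} (tau : topology X).
Implicit Types (u v x y z : X) (A D V W : set X).

Hypothesis mt : minimal_topology tau.

Let hls : hausdorff_locally_solid tau := mt.1.
Let N := solid_nbhs tau.
Let hN : solid_base N := solid_nbhs_base hls.

(** The positive part of an order dense ideal is the typical example; asking
    only for sums spares the verification of the ideal axioms. *)
Record total_positive A : Prop := {
  tpos_ge0 : forall a, A a -> 0 <= a ;
  tposD : forall a b, A a -> A b -> A (a + b) ;
  tpos_inhabited : A !=set0 ;
  tpos_total : forall x, 0 <= x -> (forall a, A a -> vmeet x a = 0) -> x = 0
}.

(** The truncated neighbourhoods form a solid base: sums of elements of A make it
    directed, totality makes it separated, and truncation only shrinks absolute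
    values, so the topology it generates is coarser than tau. *)
Lemma minimal_unbounded A V : total_positive A -> N V ->
  exists a W, [/\ A a, N W & forall x, W (vmeet (vabs x) a) -> V x].
Proof.
move=> tA NV.
pose trunc (a : X) W := [set x | W (vmeet (vabs x) a)].
have truncS W x y a b : N W -> 0 <= b -> vabs y <= vabs x -> b <= a ->
    trunc a W x -> trunc b W y.
  move=> NW b0 yx ba Wx; apply: (sbase_le hN NW Wx).
    by apply: vmeet_ge0; rewrite ?vabs_ge0.
  exact: vle_meet2.
have truncN W a : A a -> N W -> W `<=` trunc a W.
  move=> /(tpos_ge0 tA) a0 NW x /(sbase_abs hN _ NW)/(sbase_le hN NW); apply.
    by apply: vmeet_ge0; rewrite ?vabs_ge0.
  exact: vge_meetl.
pose B := [set U | exists a W, [/\ A a, N W & U = trunc a W]].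
have [||U [a [W [Aa NW ->]]] UV] := @minimal_base _ _ tau hls mt B V _ _ NV.
- have [a0 Aa0] := tpos_inhabited tA.
  split.
  + by have [W NW] := sbase_inhabited hN; exists (trunc a0 W), a0, W.
  + move=> _ [a [W [Aa NW ->]]] x y Wx yx.
    by apply: (truncS _ _ _ _ _ NW (tpos_ge0 tA Aa) yx (lexx a) Wx).
  + move=> _ _ [a [V1 [Aa NV1 ->]]] [b [V2 [Ab NV2 ->]]].
    have [W NW WV] := sbase_meet hN NV1 NV2.
    exists (trunc (a + b) W); first by exists (a + b), W; split => //; exact: tposD.
    have [a_ge0 b_ge0] := (tpos_ge0 tA Aa, tpos_ge0 tA Ab).
    move=> x Wx; split.
      have /WV[] : trunc a W x.
        by apply: (truncS _ _ _ _ _ NW) Wx => //; rewrite -[leLHS]addr0 vleD2l.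
      by [].
    have /WV[] : trunc b W x.
      by apply: (truncS _ _ _ _ _ NW) Wx => //; rewrite -[leLHS]add0r vleD2r.
    by [].
  + move=> _ [a [V1 [Aa NV1 ->]]]; have [W NW hW] := sbase_half hN NV1.
    have a_ge0 := tpos_ge0 tA Aa.
    exists (trunc a W); first by exists a, W.
    move=> x y Wx Wy; apply: (sbase_le hN NV1 (hW _ _ Wx Wy)).
      by apply: vmeet_ge0; rewrite ?vabs_ge0.
    apply: le_trans (vmeet_subadd (vabs_ge0 x) (vabs_ge0 y) a_ge0).
    by apply: vle_meet2 (lexx _); exact: vabsD_le.
  + move=> _ x [a [W [Aa NW ->]]].
    have [n [v [Wv ->]]] := sbase_absorbing hN x NW.
    by exists n, v; split => //; exact: (truncN _ _ Aa NW v Wv).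
  + move=> x hx; apply: vabs_eq0; apply: (tpos_total tA (vabs_ge0 x)) => a Aa.
    by apply: (sbase_separated hN) => W NW; apply: (hx (trunc a W)); exists a, W.
- move=> _ [a [W [Aa NW ->]]]; split.
    move=> x y Wx yx; by apply: (truncS _ _ _ _ _ NW (tpos_ge0 tA Aa) yx (lexx a) Wx).
  exact: filterS (truncN _ _ Aa NW) NW.2.
- by exists a, W; split => // x Wx; exact: UV.
Qed.

(** Write u = (n + 1) v with u in D and v small. The positive a with
    a /\ (d - v)^+ = 0 for some d in D form a total set: if x is disjoint from
    all of them, then x is disjoint from every (v - d)^+, so x /\ v <= d for
    all d in D, whence x /\ u = 0 and x itself is one of these a. Unboundedness
    for this set makes some (d - v)^+ small, and d <= (d - v)^+ + v. *)
Lemma minimal_lebesgue D V :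
  D !=set0 -> (forall d e, D d -> D e -> exists2 f, D f & f <= d /\ f <= e) ->
  infimums D 0 -> N V -> exists2 d, D d & V d.
Proof.
move=> [u Du] dirD [lbD glbD] NV; have [W NW hW] := sbase_half hN NV.
have [n [v [Wv uv]]] := sbase_absorbing hN u NW.
have u0 : 0 <= u by exact: lbD.
have v0 : 0 <= v by apply: (@vmulrn_ge0_inv _ _ _ n); rewrite -uv.
pose A := [set a | 0 <= a /\ exists2 d, D d & vmeet a (vpos (d - v)) = 0].
have tA : total_positive A.
  split.
  - by move=> a [].
  - move=> a b [a0 [d Dd ad]] [b0 [e De be]]; split; first exact: vaddr_ge0.
    have [f Df [fd fe]] := dirD _ _ Dd De; exists f => //.
    apply: le_anti; rewrite vmeet_ge0 ?vaddr_ge0 ?vpos_ge0// andbT.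
    apply: le_trans (vmeet_subadd a0 b0 (vpos_ge0 _)) _.
    rewrite -[0]addr0 -{1}ad -be.
    by apply: vleD; apply: vle_meet2 (lexx _) _; apply: vpos_le2; rewrite vleD2r.
  - exists 0; split => //; exists u => //; apply: vmeet_l; exact: vpos_ge0.
  - move=> x x0 xA.
    have xv : vmeet x v = 0.
      apply: le_anti; rewrite vmeet_ge0// andbT; apply: glbD => d Dd.
      have Avd : A (vpos (v - d)).
        split; first exact: vpos_ge0.
        by exists d => //; rewrite vmeetC -[v - d]opprB vpos_disjoint.
      have vd : v <= vpos (v - d) + d by rewrite -vleBlDr vle_pos.
      apply: le_trans (vle_meet2 (lexx x) vd) _.
      rewrite vmeetC; apply: le_trans (vmeet_subadd _ _ _) _ => //.
      - exact: vpos_ge0.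
      - exact: lbD.
      by rewrite vmeetC (xA _ Avd) add0r vge_meetl.
    have xu : vmeet x u = 0.
      apply: le_anti; rewrite vmeet_ge0// andbT uv vmeetC.
      by apply: le_trans (vmeet_mulrn _ _ _) _ => //; rewrite vmeetC xv mul0rn.
    (* x is disjoint from itself because (u - v)^+ <= u puts x in A. *)
    rewrite -(vmeet_l (lexx x)); apply: xA; split => //; exists u => //.
    apply: le_anti; rewrite vmeet_ge0 ?vpos_ge0// andbT -xu.
    apply: vle_meet2 => //; rewrite /vpos vleUx u0 andbT vleBlDr.
    by rewrite -[leLHS]addr0 vleD2l.
have [a [W' [[a0 [d Dd ad]] NW' hW']]] := minimal_unbounded tA NW.
exists d => //.
have Wd : W (vpos (d - v)).
  by apply: hW'; rewrite vabs_id ?vpos_ge0// vmeetC ad; exact: (sbase0 hN).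
apply: (sbase_le hN NV (hW _ _ Wd Wv)); first exact: lbD.
by rewrite -vleBlDr vle_pos.
Qed.

End MinimalTopology.

(** * Disjoint sets and the countable sup property *)

Section CountableDisjoint.
Context {R : realType} {X Xu : vectorLatticeType R} (i : {linear X -> Xu}).

(** Let s be the supremum of the image of E, which exists by lateral
    completeness, and B a countable part of the image with supremum s. A d in E
    with i d outside B is disjoint from B, so s - i d still bounds B, which forces
    i d <= 0. *)
Lemma countable_disjoint (E : set X) :
  is_universal_completion i -> countable_sup_property Xu ->
  (forall a, E a -> 0 < a) ->
  (forall a b, E a -> E b -> a != b -> vmeet a b = 0) -> countable E.
Proof.
move=> hi csp Epos Edisj.
have [->|/set0P E0] := eqVneq E set0; first exact: countable0.
have ipos a : 0 <= a -> 0 <= i a.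
  move=> /vmeet_l a0; have := ucompl_meet hi 0 a; rewrite a0 linear0 => ->.
  exact: vge_meetr.
have iE0 : i @` E !=set0 by case: E0 => d Ed; exists (i d), d.
have [s sE] : supremums (i @` E) !=set0.
  apply: (ucompl_complete hi).2 => //.
    by move=> _ [a /Epos/ltW a0 <-]; exact: ipos.
  move=> _ _ [a Ea <-] [b Eb <-] ab; rewrite -(ucompl_meet hi) Edisj ?linear0//.
  by apply: contraNneq ab => ->.
have [B [BE cB [Bs sB]]] := csp _ _ iE0 sE.
suff EB : i @` E `<=` B.
  have /card_esym/eq_countable -> : (i @` E #= E)%card.
    by apply: inj_card_eq => x y _ _; exact: (ucompl_inj hi).
  exact: sub_countable (subset_card_le EB) cB.
move=> _ [d Ed <-]; apply: contrapT => nBd.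
have d0 := Epos _ Ed.
have : s <= s - i d.
  apply: sB => b Bb; have [e Ee eb] := BE _ Bb; subst b.
  have ed : e != d by apply: contra_notN nBd => /eqP <-.
  rewrite vleBrDr; apply: le_trans (vadd_le_join_meet _ _) _.
  rewrite -(ucompl_meet hi) Edisj// linear0 addr0 vleUx Bs//=.
  by apply: sE.1; exists d.
rewrite vleBrDr -[leRHS]addr0 vleD2l => id0.
have /(ucompl_inj hi) d00 : i d = i 0.
  by rewrite linear0; apply: le_anti; rewrite id0 ipos ?ltW.
by move: d0; rewrite d00 ltxx.
Qed.

End CountableDisjoint.

(** * Normal sequences of solid neighbourhoods *)

Section Archimedean.
Context {R : realType} {X : vectorLatticeType R}.
Hypothesis archX : archimedean X.

(** If w is below the gap y - a for all upper bounds y, then y - w^+ is again an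
    upper bound; iterating, the multiples of w^+ stay bounded. *)
Lemma archimedean_gap (A : set X) : has_sup A ->
  infimums [set y - a | y in ubound A & a in A] 0.
Proof.
move=> [[a0 Aa0] [y0 Ay0]]; split.
  by move=> _ [y Ay [a Aa <-]]; rewrite vsub_ge0; exact: Ay.
move=> w lw.
have sub y : ubound A y -> ubound A (y - vpos w).
  move=> Ay a Aa; rewrite vleBrDr addrC -vleBrDr /vpos vleUx vsub_ge0 Ay// andbT.
  by apply: lw; exists y => //; exists a.
have subn n : ubound A (y0 - vpos w *+ n).
  elim: n => [|n IH]; first by rewrite mulr0n subr0.
  by rewrite mulrSr opprD addrA; exact: sub.
have -> : 0 = vpos w; last exact: vle_pos.
apply/esym/(archX (y := y0 - a0)); first exact: vpos_ge0.
by move=> n; rewrite vleBrDr addrC -vleBrDr; exact: subn.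
Qed.

End Archimedean.

Section NormalSequences.
Context {R : realType} {X : vectorLatticeType R} (tau : topology X).
Hypotheses (mt : minimal_topology tau) (archX : archimedean X).
Implicit Types (W : nat -> set X) (u x : X).

Let N := solid_nbhs tau.
Let hN : solid_base N := solid_nbhs_base mt.1.

Definition normal_sequence W :=
  (forall k, N (W k)) /\ forall k x y, W k.+1 x -> W k.+1 y -> W k (x + y).

Definition normal_kernel W := \bigcap_k W k.

Lemma normal_sequence_dec W k m : normal_sequence W -> (k <= m)%N ->
  W m `<=` W k.
Proof.
move=> [NW hW]; elim: m => [|m IH]; first by rewrite leqn0 => /eqP ->.
rewrite leq_eqVlt => /predU1P[<-//|/IH WmWk] x Wx; apply: WmWk.
by rewrite -[x]addr0; apply: hW => //; exact: (sbase0 hN).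
Qed.

Lemma normal_sequence_ex V : N V -> exists2 W, normal_sequence W & W 0 = V.
Proof.
move=> NV.
have /choice[h hh] (U : set X) : exists U', N U ->
    N U' /\ forall x y, U' x -> U' y -> U (x + y).
  have [NU|nNU] := pselect (N U); last by exists U.
  by have [U' NU' hU'] := sbase_half hN NU; exists U'.
pose W k := iter k h V.
have NW k : N (W k) by elim: k => //= k IH; exact: (hh _ IH).1.
by exists W => //; split => // k; exact: (hh _ (NW k)).2.
Qed.

Lemma kernel_le W x y : normal_sequence W -> normal_kernel W y ->
  0 <= x -> x <= y -> normal_kernel W x.
Proof. by move=> [NW _] Ky x0 xy k _; exact: (sbase_le hN (NW k) (Ky k I)). Qed.

Lemma kernelD W x y : normal_sequence W -> normal_kernel W x -> normal_kernel W y ->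
  normal_kernel W (x + y).
Proof. by move=> [_ hW] Kx Ky k _; apply: hW; [exact: Kx|exact: Ky]. Qed.

Lemma kernel0 W : normal_sequence W -> normal_kernel W 0.
Proof. by move=> [NW _] k _; exact: (sbase0 hN). Qed.

(** The kernel is closed under suprema. The part A of the kernel below u has
    supremum u: a gap w > 0 between A and u would dominate some e > 0 of the
    kernel, and then all multiples of e would lie in A, against the Archimedean
    property. By the Lebesgue property u - a is small for some a in A. *)
Lemma kernel_order_dense W u : normal_sequence W -> 0 <= u ->
  (forall d, 0 < d <= u -> exists2 e, normal_kernel W e & 0 < e <= d) ->
  normal_kernel W u.
Proof.
move=> nW u0 dens.
pose A := [set a | normal_kernel W a /\ 0 <= a <= u].
pose D := [set u - a | a in A].
have A0 : A 0 by split; [exact: kernel0|rewrite lexx].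
have D0 : infimums D 0.
  split; first by move=> _ [a [_ /andP[_ au]] <-]; rewrite vsub_ge0.
  move=> w lw.
  have wle a : A a -> vpos w <= u - a.
    move=> Aa; rewrite /vpos vleUx vsub_ge0 lw; last by exists a.
    by case: Aa => _ /andP[].
  have [w0|w0] := eqVneq (vpos w) 0; first by rewrite -w0 vle_pos.
  have [|e Ke /andP[e0 ew]] := dens (vpos w).
    by rewrite lt_neqAle eq_sym w0 vpos_ge0 -[u]subr0 wle.
  have Ae n : A (e *+ n).
    elim: n => [|n IH]; first by rewrite mulr0n.
    split; first by rewrite mulrS; apply: kernelD => //; case: IH.
    rewrite (vmulrn_ge0 _ (ltW e0)) mulrS -vleBrDr.
    exact: le_trans ew (wle _ IH).
  have e00 : e = 0.
    by apply: (archX (y := u)) => [|n]; [exact: ltW|case: (Ae n) => _ /andP[]].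
  by move: e0; rewrite e00 ltxx.
have dirD d e : D d -> D e -> exists2 f, D f & f <= d /\ f <= e.
  move=> [a [Ka /andP[a0 au]] <-] [b [Kb /andP[b0 bu]] <-].
  exists (u - vjoin a b); last by rewrite !vleD2l !vleN2 vle_joinl vle_joinr.
  have j0 : 0 <= vjoin a b by exact: le_trans a0 (vle_joinl _ _).
  exists (vjoin a b) => //; split; last by rewrite j0 vleUx au.
  apply: kernel_le (kernelD nW Ka Kb) j0 _ => //.
  by rewrite vleUx -{1}[a]addr0 -{2}[b]add0r vleD2l vleD2r b0.
move=> k _; have [] := minimal_lebesgue mt _ dirD D0 (nW.1 k.+1).
  by exists (u - 0), 0.
move=> _ [a [Ka _] <-] Wua; rewrite -(subrK a u).
by apply: nW.2 => //; exact: Ka.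
Qed.

(** d lies in the disjoint complement of the kernel, the band on which W
    separates points. *)
Definition carried W d := forall e, normal_kernel W e -> 0 <= e -> vmeet d e = 0.

(** Start a normal sequence with a neighbourhood that misses u. Were no such d
    to exist, the kernel would be order dense below u and would contain u. *)
Lemma carried_ex u : 0 < u ->
  exists W d, [/\ normal_sequence W, 0 < d <= u & carried W d].
Proof.
move=> u0; have [V NV nVu] : exists2 V, N V & ~ V u.
  apply: contrapT => nV; move: u0; rewrite (_ : u = 0) ?ltxx//.
  apply: (sbase_separated hN) => V NV; apply: contrapT => nVu; apply: nV.
  by exists V.
have [W nW W0] := normal_sequence_ex NV.
apply: contrapT => nex; apply: nVu; rewrite -W0.
apply: (kernel_order_dense nW (ltW u0) _ I) => d /andP[d0 du].
apply: contrapT => nd; apply: nex; exists W, d; split; rewrite ?d0// => e Ke e0.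
apply: contrapT => /eqP de; apply: nd; exists (vmeet d e).
  by apply: (kernel_le nW Ke (vmeet_ge0 (ltW d0) e0)); exact: vge_meetr.
by rewrite lt_neqAle eq_sym de vmeet_ge0 ?vge_meetl// ltW.
Qed.

(** W k is the intersection of S j k over j <= k: finitely many neighbourhoods
    at each stage, all the S j in the end. *)
Lemma diagonal_sequence (S : nat -> nat -> set X) :
  (forall j, normal_sequence (S j)) ->
  exists2 W, normal_sequence W & forall j, normal_kernel W `<=` normal_kernel (S j).
Proof.
move=> nS; pose W k := [set x | forall j, (j <= k)%N -> S j k x].
have nW : normal_sequence W.
  split => [k|k x y Wx Wy j jk]; last first.
    by apply: (nS j).2; [apply: Wx|apply: Wy]; exact: leqW.
  split=> [x y Wx yx j jk|].
    exact: (sbase_solid hN ((nS j).1 k)) (Wx j jk) yx.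
  suff h n : nbhs (0 : topologized tau) [set x | forall j, (j < n)%N -> S j k x].
    exact: h k.+1.
  elim: n => [|n IH]; first by apply: filterS filterT => x _ j.
  apply: filterS (filterI IH ((nS n).1 k).2) => x [Sx Snx] j.
  by rewrite ltnS leq_eqVlt => /predU1P[->|/Sx].
exists W => // j x Kx k _.
apply: (normal_sequence_dec (nS j) (leq_maxr j k)).
exact: (Kx (maxn j k) I j (leq_maxl j k)).
Qed.

(** Take a maximal disjoint set E of vectors each carried by some normal
    sequence, and a diagonal sequence for these countably many sequences. Its
    kernel is disjoint from E, while a nonzero vector of the kernel would have
    below it a carried vector, contradicting the maximality of E. *)
Lemma normal_sequence_separating :
  (forall E : set X, (forall a, E a -> 0 < a) ->
     (forall a b, E a -> E b -> a != b -> vmeet a b = 0) -> countable E) ->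
  exists2 W, normal_sequence W & normal_kernel W `<=` [set 0].
Proof.
move=> ccc.
pose T := [set d | 0 < d /\ exists2 W, normal_sequence W & carried W d].
(* Two positive vectors are disjoint iff their sets F meet emptily, which
   expresses disjointness of vectors as disjointness of sets. *)
pose F (d : X) := [set z | 0 < z <= d].
have [E [ET tE maxE]] := ex_maximal_disjoint_subcollection F T.
have Edisj a b : E a -> E b -> a != b -> vmeet a b = 0.
  move=> Ea Eb /eqP ab; apply: contrapT => /eqP m0; apply: ab.
  apply: tE => //; exists (vmeet a b).
  have mpos : 0 < vmeet a b.
    by rewrite lt_neqAle eq_sym m0 vmeet_ge0// ltW// (ET _ _).1.
  by split; rewrite /F/= mpos ?vge_meetl ?vge_meetr.
have /countable_injP[f finj] : countable E.
  by apply: ccc Edisj => a /ET[].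
(* W0 fills the indices j that are not values of f on E. *)
have [V NV] := sbase_inhabited hN; have [W0 nW0 _] := normal_sequence_ex NV.
have /choice[S hS] j : exists W, normal_sequence W /\
    forall d, E d -> f d = j -> carried W d.
  have [[d [Ed fd]]|nd] := pselect (exists d, E d /\ f d = j).
    have [_ [W nW cW]] := ET _ Ed; exists W; split => // e Ee fe.
    by rewrite (finj e d) ?inE// fe fd.
  by exists W0; split => // d Ed fd; case: nd; exists d.
have [W nW KW] := diagonal_sequence (fun j => (hS j).1).
exists W => // x Kx; apply: vabs_eq0.
have Kax : normal_kernel W (vabs x).
  by move=> k _; apply: (sbase_abs hN x (nW.1 k)).1; exact: Kx.
apply: contrapT => /eqP x0.
have [|W' [d [nW' /andP[d0 dx] cd]]] := @carried_ex (vabs x).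
  by rewrite lt_neqAle eq_sym x0 vabs_ge0.
have dE e : E e -> vmeet e d = 0.
  move=> Ee; have e0 : 0 <= e by rewrite ltW// (ET _ _).1.
  apply: le_anti; rewrite vmeet_ge0 ?(ltW d0)// andbT.
  rewrite -((hS (f e)).2 e Ee erefl (vabs x)) ?vabs_ge0//; last exact: KW.
  exact: vle_meet2.
have ndisj e : E e -> F e `&` F d = set0.
  move=> Ee; rewrite -subset0 => z [/andP[z0 ze] /andP[_ zd]].
  by have := lt_le_trans z0 (_ : z <= 0); rewrite ltxx -(dE e Ee) vlexI ze zd => /(_ isT).
apply: (maxE (E `|` [set d])).
- split; first by move=> e; left.
  move=> /(_ d (or_intror erefl))/dE; rewrite vmeet_l// => d00.
  by move: d0; rewrite d00 ltxx.
- by move=> e [/ET//|->]; split => //; exists W'.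
- move=> a b [Ea|->] [Eb|->] //; first exact: tE.
  + by rewrite ndisj// => -[].
  + by rewrite setIC ndisj// => -[].
Qed.

End NormalSequences.

(** * Topological and unbounded order convergence *)

Lemma strictly_increasing_choice (P : nat -> nat -> Prop) :
  (forall k n0, exists2 n, (n0 <= n)%N & P k n) ->
  exists2 psi, strictly_increasing psi & forall k, P k (psi k).
Proof.
move=> hP; have /choice[h hh] (kn : nat * nat) :
    exists n, (kn.2 <= n)%N /\ P kn.1 n.
  by have [n] := hP kn.1 kn.2; exists n.
pose psi := fix psi k := if k is k'.+1 then h (k, (psi k').+1) else h (0, 0)%N.
exists psi; last by case=> [|k]; [exact: (hh (0, 0)%N).2|exact: (hh (k.+1, _)).2].
by apply: homo_ltn => [|k]; [exact: ltn_trans|exact: (hh (k.+1, (psi k).+1)).1].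
Qed.

Section UoConvergence.
Context {R : realType} {X : vectorLatticeType R} (tau : topology X).
Hypothesis mt : minimal_topology tau.
Implicit Types (x z : nat -> X) (V : set X).

Let N := solid_nbhs tau.
Let hN : solid_base N := solid_nbhs_base mt.1.

Lemma topo_cvg0P x : topo_cvg tau x 0 <->
  forall V, N V -> exists n0, forall n, (n0 <= n)%N -> V (x n).
Proof.
split => [cx V [_ V0]|hx V /(solid_nbhs_sub mt.1)[W /hx[n0 hn0] WV]].
  by have [n0 _ hn0] := cx _ V0; exists n0 => n; exact: hn0.
by exists n0 => // n /= /hn0/WV.
Qed.

(** By unboundedness it is enough that |z n| /\ a is small for one a, and this is
    dominated by a net decreasing to zero, small by the Lebesgue property. *)
Lemma uo_cvg0_topo_cvg0 z : seq_uo_cvg z 0 -> topo_cvg tau z 0.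
Proof.
move=> uoz; apply/topo_cvg0P => V NV.
have tA : @total_positive R X [set a | 0 <= a].
  split => //; first exact: vaddr_ge0.
    by exists 0 => /=.
  by move=> x x0 /(_ x x0); rewrite vmeet_l.
have [a [W [a0 NW hW]]] := minimal_unbounded mt tA NV.
have [J [leJ [y [dirJ [ydec yinf] zy]]]] := uoz a a0.
have [||_ [j _ <-] Wyj] := minimal_lebesgue mt _ _ yinf NW.
- by have [[j]] := dirJ; exists (y j), j.
- move=> _ _ [j _ <-] [k _ <-]; have [l jl kl] := directed_ub dirJ j k.
  by exists (y l); [exists l|split; exact: ydec].
have [n0 hn0] := zy j; exists n0 => n /hn0; rewrite !subr0 => h; apply: hW.
apply: (sbase_le hN NW Wyj); first by apply: vmeet_ge0; rewrite ?vabs_ge0.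
by apply: le_trans h; exact: vle_abs.
Qed.

Section DominatedTails.
Variables (W : nat -> set X) (t : nat -> X) (u : X).
Hypotheses (nW : normal_sequence tau W) (Wt : forall k, W k.+1 (t k)).
Hypotheses (t0 : forall k, 0 <= t k) (tu : forall k, t k <= u).

Fixpoint tail_join m k := if m is m'.+1 then vjoin (t k) (tail_join m' k.+1) else t k.

Lemma tail_join_ge0 m k : 0 <= tail_join m k.
Proof. by case: m => //= m; exact: le_trans (t0 k) (vle_joinl _ _). Qed.

Lemma tail_join_le m k : tail_join m k <= u.
Proof. by elim: m k => //= m IH k; rewrite vleUx tu IH. Qed.

Lemma tail_join_mono m n k : (m <= n)%N -> tail_join m k <= tail_join n k.
Proof.
elim: n m k => [|n IH] [|m] k //= mn; first exact: vle_joinl.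
by apply: vle_join2 => //; exact: IH.
Qed.

Lemma le_tail_join m k : t (k + m) <= tail_join m k.
Proof.
elim: m k => [|m IH] k /=; first by rewrite addn0.
by rewrite addnS -addSn; exact: le_trans (IH _) (vle_joinr _ _).
Qed.

(** The halving property sums the estimates from the far end of the tail:
    t k is in W (k+1), and so is the join of the remaining terms. *)
Lemma tail_join_small m k : W k (tail_join m k).
Proof.
elim: m k => [|m IH] k /=.
  by apply: (normal_sequence_dec mt nW (leqnSn k)); exact: Wt.
apply: (sbase_le hN (nW.1 k) (nW.2 _ _ _ (Wt k) (IH k.+1))).
  exact: le_trans (t0 k) (vle_joinl _ _).
rewrite vleUx -{1}[t k]addr0 vleD2l tail_join_ge0 /=.
by rewrite -{1}[tail_join _ _]add0r vleD2r t0.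
Qed.

(** These upper bounds of tails stand in for the suprema of the tails, which need
    not exist. *)
Definition eventual_ubound := [set y | exists k, forall j, (k <= j)%N -> t j <= y].

Hypothesis archX : archimedean X.

(** The upper bounds y of the finite joins s of the tail from k+1 on come
    arbitrarily close to these joins, so y - s and s are both in W (k+1) for
    some y and s. *)
Lemma eventual_ubound_small k : exists2 y, eventual_ubound y & W k y.
Proof.
pose A := range (tail_join^~ k.+1).
have Au : ubound A u by move=> _ [m _ <-]; exact: tail_join_le.
have supA : has_sup A by split; [exists (tail_join 0 k.+1), 0%N|exists u].
have [||_ [y Ay [_ [m _ <-] <-]] Wy] :=
  minimal_lebesgue mt _ _ (archimedean_gap archX supA) (nW.1 k.+1).
- exists (u - tail_join 0 k.+1), u => //.
  by exists (tail_join 0 k.+1) => //; exists 0%N.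
- move=> _ _ [y Ay [_ [m _ <-] <-]] [y' Ay' [_ [m' _ <-] <-]].
  exists (vmeet y y' - tail_join (maxn m m') k.+1).
    exists (vmeet y y').
      by move=> a Aa; rewrite vlexI Ay//= Ay'.
    by exists (tail_join (maxn m m') k.+1) => //; exists (maxn m m').
  by split; apply: vleB; rewrite ?vge_meetl ?vge_meetr// tail_join_mono
    ?leq_maxl ?leq_maxr.
exists y.
  exists k.+1 => j kj; apply: le_trans (Ay _ _); last by exists (j - k.+1)%N.
  by have := le_tail_join (j - k.+1) k.+1; rewrite subnKC.
by rewrite -(subrK (tail_join m k.+1) y); apply: nW.2 => //; exact: tail_join_small.
Qed.

Lemma eventual_ubound_inf : normal_kernel W `<=` [set 0] -> infimums eventual_ubound 0.
Proof.
move=> KW; split; first by move=> y [k hk]; exact: le_trans (t0 k) (hk k (leqnn k)).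
move=> w lw; have <- : vpos w = 0; last exact: vle_pos.
apply: KW => k _; have [y Yy Wy] := eventual_ubound_small k.
apply: (sbase_le hN (nW.1 k) Wy (vpos_ge0 _)).
rewrite /vpos vleUx lw//=.
by case: Yy => n hn; exact: le_trans (t0 n) (hn n (leqnn n)).
Qed.

End DominatedTails.

(** The dominating net is the set of eventual upper bounds itself, ordered
    downwards. *)
Lemma normal_sequence_uo_cvg0 (W : nat -> set X) z : archimedean X ->
  normal_sequence tau W -> normal_kernel W `<=` [set 0] ->
  (forall k, W k.+1 (z k)) -> seq_uo_cvg z 0.
Proof.
move=> archX nW KW Wz u u0; pose t n := vmeet (vabs (z n - 0)) u.
have t0 n : 0 <= t n by apply: vmeet_ge0; rewrite ?vabs_ge0.
have Wt n : W n.+1 (t n).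
  have /(sbase_abs hN _ (nW.1 n.+1)) Wzn := Wz n.
  apply: (sbase_le hN (nW.1 n.+1) Wzn (t0 n)).
  by rewrite /t subr0; exact: vge_meetl.
have tu n : t n <= u by exact: vge_meetr.
pose Y := eventual_ubound t.
have Yinf : infimums Y 0 by exact: (eventual_ubound_inf nW Wt t0 tu archX KW).
exists {y | Y y}, (fun a b => sval b <= sval a), sval; split.
- split => //.
  + by constructor; exists u; exists 0%N => j _; exact: tu.
  + by move=> a b c ab bc; exact: le_trans bc ab.
  + move=> [a [k ak]] [b [l bl]].
    have Yab : Y (vmeet a b).
      exists (maxn k l) => j; rewrite geq_max => /andP[kj lj].
      by rewrite vlexI ak//= bl.
    by exists (exist _ _ Yab) => /=; rewrite ?vge_meetl ?vge_meetr.
- split => //; rewrite (_ : range _ = Y) //.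
  apply/seteqP; split => [_ [[y Yy] _ <-]//|y Yy].
  by exists (exist _ _ Yy).
- move=> [y [k hk]]; exists k => n /hk tn /=.
  by rewrite subr0 vabs_id; [exact: tn|exact: t0].
Qed.

End UoConvergence.

Theorem corollary6p9 (R : realType) (X : vectorLatticeType R)
    (tau : topology X) (Xu : vectorLatticeType R) (i : {linear X -> Xu})
    (x : nat -> X) :
  archimedean X -> minimal_topology tau ->
  is_universal_completion i -> countable_sup_property Xu ->
  topo_cvg tau x 0%R <->
  (forall phi : nat -> nat, strictly_increasing phi ->
     exists2 psi : nat -> nat, strictly_increasing psi &
       seq_uo_cvg (fun n => x (phi (psi n))) 0%R).
Proof.
move=> archX mt hi csp; split => [/(topo_cvg0P mt) cx phi incphi|sub].
  have [W nW KW] := normal_sequence_separating mt archX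
    (fun E => countable_disjoint hi csp).
  have phi_ge n : (n <= phi n)%N.
    by elim: n => // n IH; exact: leq_ltn_trans IH (incphi _ _ (ltnSn n)).
  have [k n0|psi incpsi Wpsi] :=
      @strictly_increasing_choice (fun k n => W k.+1 (x (phi n))).
    have [m hm] := cx _ (nW.1 k.+1); exists (maxn n0 m); first exact: leq_maxl.
    by apply: hm; apply: leq_trans (phi_ge _); exact: leq_maxr.
  by exists psi => //; exact: normal_sequence_uo_cvg0 mt _ _ archX nW KW Wpsi.
apply/(topo_cvg0P mt) => V NV; apply: contrapT => nV.
have [_ n0|phi incphi nVphi] := @strictly_increasing_choice (fun _ n => ~ V (x n)).
  apply: contrapT => nn; apply: nV; exists n0 => n n0n.
  by apply: contrapT => nVn; apply: nn; exists n.
have [psi _ /(uo_cvg0_topo_cvg0 mt)/(topo_cvg0P mt) cpsi] := sub phi incphi.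
by have [n hn] := cpsi V NV; exact: nVphi (hn n (leqnn n)).
Qed.
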